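(* Kleene–Vesley realizability (the topos $\mathbf{RT}(\mathcal{K}_2^{\mathrm{rec}}, \mathcal{K}_2)$) does not validate the statement ''$\mathbb{N}_\infty$ has the Myhill property''.
   Context: $\mathcal{K}_2$ is Kleene's second algebra, the partial combinatory algebra on $\mathbb{N}^{\mathbb{N}}$ in which $e \cdot q$ is the result of applying the partial continuous function $\mathbb{N}^\mathbb{N} \rightharpoonup \mathbb{N}^\mathbb{N}$ coded by $e$ to $q$; $\mathcal{K}_2^{\mathrm{rec}}$ is its sub-algebra of computable sequences. The Kleene–Vesley topos $\mathbf{RT}(\mathcal{K}_2^{\mathrm{rec}}, \mathcal{K}_2)$ is the relative realizability topos in which realizers range over $\mathcal{K}_2$ and a statement is valid iff it has a realizer in $\mathcal{K}_2^{\mathrm{rec}}$. The metatheory is classical. The following definitions are interpreted in the internal logic. $\mathbb{N}_\infty \subseteq 2^{\mathbb{N}}$ is the set of bit sequences containing at most one $1$. A set $X$ has the Myhill property if for all subsets $A, B \subseteq X$: if there are injections $f, g : X \to X$ with $A = f^{-1}(B)$ and $B = g^{-1}(A)$, then there is a bijection $h : X \to X$ which restricts to a bijection between $A$ and $B$. *)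

(* Defs.v *)
(* Plain MathComp. *)
From mathcomp Require Import all_boot.

Set Implicit Arguments.
Unset Strict Implicit.
Unset Printing Implicit Defensive.

(* Mu-recursive programs; [evaluates c xs y] means that the program c halts
   with value y on the list of arguments xs. *)
Inductive prog : Type :=
  | Zero
  | Succ
  | Proj of nat
  | Comp of prog & seq prog
  | Prec of prog & prog
  | Mu of prog.

Inductive evaluates : prog -> seq nat -> nat -> Prop :=
  | ev_zero xs : evaluates Zero xs 0
  | ev_succ x xs : evaluates Succ (x :: xs) x.+1
  | ev_proj i xs : i < size xs -> evaluates (Proj i) xs (nth 0 xs i)
  | ev_comp c cs xs ys z :
      evaluates_all cs xs ys -> evaluates c ys z -> evaluates (Comp c cs) xs z
  | ev_prec0 c d xs z : evaluates c xs z -> evaluates (Prec c d) (0 :: xs) z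
  | ev_precS c d n xs y z :
      evaluates (Prec c d) (n :: xs) y -> evaluates d (n :: y :: xs) z ->
      evaluates (Prec c d) (n.+1 :: xs) z
  | ev_mu c xs n :
      evaluates c (n :: xs) 0 ->
      (forall m, m < n -> exists k, evaluates c (m :: xs) k.+1) ->
      evaluates (Mu c) xs n
with evaluates_all : seq prog -> seq nat -> seq nat -> Prop :=
  | ev_nil xs : evaluates_all [::] xs [::]
  | ev_cons c cs xs y ys :
      evaluates c xs y -> evaluates_all cs xs ys ->
      evaluates_all (c :: cs) xs (y :: ys).

Definition K2 : Type := nat -> nat.

Definition computable (a : K2) : Prop :=
  exists c : prog, forall n, evaluates c [:: n] (a n).

(* [app e q r] is the graph of the partial application: e . q is defined and
   equal to r.  On input n the code e is queried on n followed by longer and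
   longer prefixes of q, where 0 means "not enough information yet" and v.+1
   means "the answer is v".  CodeSeq.code is a (computable) bijection from
   finite sequences to nat. *)
Definition app (e q r : K2) : Prop :=
  forall n, exists k,
    (forall j, j < k -> e (CodeSeq.code (n :: mkseq q j)) = 0) /\
    e (CodeSeq.code (n :: mkseq q k)) = (r n).+1.

(* Propositions of the realizability tripos: sets of realizers in K2. *)
Definition tv : Type := K2 -> Prop.

Definition valid (p : tv) : Prop := exists2 e, computable e & p e.

Definition rand (p q : tv) : tv :=
  fun e => p (fun n => e n.*2) /\ q (fun n => e n.*2.+1).

Definition rimp (p q : tv) : tv :=
  fun e => forall a, p a -> exists2 b, app e a b & q b.

Definition riff (p q : tv) : tv := rand (rimp p q) (rimp q p).

(* Quantifiers of the tripos over a bare set: uniform in the element. *)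
Definition runif (T : Type) (p : T -> tv) : tv := fun e => forall t, p t e.

(* Objects of the topos: a set with a K2-valued equality; req x x is the
   existence predicate.  That req is a (validly) symmetric and transitive
   relation is not recorded: it holds for all the objects built below. *)
Record robj : Type := Robj {
  carrier :> Type;
  req : carrier -> carrier -> tv
}.
Arguments req {_} _ _.

(* Quantifiers of the internal logic, ranging over an object. *)
Definition rall (X : robj) (p : X -> tv) : tv :=
  runif (fun x => rimp (req x x) (p x)).

Definition rex (X : robj) (p : X -> tv) : tv :=
  fun e => exists x, rand (req x x) (p x) e.

Notation "p `/\ q" := (rand p q) (at level 46, right associativity).
Notation "p `-> q" := (rimp p q) (at level 57, right associativity).
Notation "p `<-> q" := (riff p q) (at level 58, no associativity).
Notation "x `= y" := (req x y) (at level 45, no associativity).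
Notation "'All' x 'of' X , p" := (@rall X (fun x => p))
  (at level 200, x binder, X at level 40, p at level 200).
Notation "'Ex' x 'of' X , p" := (@rex X (fun x => p))
  (at level 200, x binder, X at level 40, p at level 200).

Definition natO : robj := Robj (fun m n : nat => fun e => m = n /\ e 0 = n).

(* The object 2 of bits, true being the bit 1. *)
Definition bitO : robj :=
  Robj (fun b c : bool => fun e => b = c /\ e 0 = nat_of_bool c).

Definition prodO (X Y : robj) : robj :=
  Robj (fun u v : X * Y => u.1 `= v.1 `/\ u.2 `= v.2).

(* The power object: its elements are the K2-valued predicates that are strict
   and compatible with equality, two of them being equal when equivalent. *)
Definition powO (X : robj) : robj :=
  Robj (fun A B : X -> tv =>
    runif (fun x => A x `-> x `= x) `/\
    runif (fun x => runif (fun y => A x `/\ x `= y `-> A y)) `/\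
    runif (fun x => A x `<-> B x)).

(* The subobject {x : X | A x}. *)
Definition subO (X : robj) (A : X -> tv) : robj :=
  Robj (fun x y : X => x `= y `/\ A x).

(* Functions of the internal logic are functional relations F, with F (x, y)
   read as "F maps x to y". *)
Definition is_function (X Y : robj) (F : X * Y -> tv) : tv :=
  (All x of X, Ex y of Y, F (x, y)) `/\
  (All x of X, All y of Y, All y' of Y, F (x, y) `/\ F (x, y') `-> y `= y').

Definition is_injective (X Y : robj) (F : X * Y -> tv) : tv :=
  All x of X, All x' of X, All y of Y, F (x, y) `/\ F (x', y) `-> x `= x'.

Definition is_surjective (X Y : robj) (F : X * Y -> tv) : tv :=
  All y of Y, Ex x of X, F (x, y).

Definition is_bijection (X Y : robj) (F : X * Y -> tv) : tv :=
  is_function F `/\ is_injective F `/\ is_surjective F.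

Definition expO (X Y : robj) : robj :=
  subO (X := powO (prodO X Y)) (@is_function X Y).

Definition preimage (X Y : robj) (F : X * Y -> tv) (B : Y -> tv) : X -> tv :=
  fun x => Ex y of Y, F (x, y) `/\ B y.

(* [h restricts to a bijection between A and B] is expressed by: the relation h
   is a bijection from the subobject A to the subobject B. *)
Definition myhill (X : robj) : tv :=
  All A of (powO X), All B of (powO X),
    (Ex f of (expO X X), Ex g of (expO X X),
       is_injective (X := X) (Y := X) f `/\ is_injective (X := X) (Y := X) g `/\
       @req (powO X) A (preimage f B) `/\ @req (powO X) B (preimage g A)) `->
    (Ex h of (expO X X),
       is_bijection (X := X) (Y := X) h `/\
       is_bijection (X := subO A) (Y := subO B) h).

(* N_oo, as a subobject of the exponential 2^N: a (n, true) says that the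
   n-th bit of a is 1. *)
Definition Ninf : robj :=
  subO (X := expO natO bitO)
    (fun a => All n of natO, All m of natO,
       a (n, true) `/\ a (m, true) `-> n `= m).

(* Main.v *)
(* Both injections are doubling on N_oo.  For g in N_oo take the subsets
     A_g = {x | 2^j x = 2^i g for some i, j with i + j even},   B_g = likewise
   with i + j odd, a realizer of membership being the pair (i, j); everything
   assumed by the Myhill property has a realizer independent of g.  Hence so has
   its conclusion: one realizer r describes, for all g at once, a bijection h
   together with a map A_g -> B_g above it.  At x = g = oo with (i, j) = (0, 0)
   this map answers some (i, j) with i + j odd, and by continuity it gives the
   same answer at x = g = n for all large n, so 2^j h(n) = 2^i n for these n.
   If i < j, then all large n would be even; if j < i, then h(n) would be even
   for all large n and h could not be surjective.  Computability of r plays no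
   role. *)
From mathcomp Require Import all_boot boolp.
Require Import Defs.

Set Implicit Arguments.
Unset Strict Implicit.
Unset Printing Implicit Defensive.

(** * Lambda terms and their values in K2 *)

(* A lambda-calculus interpreted in K2: V is a de Bruijn index, Pr, L, R are the
   pairing of [rand] and its projections, and Op acts pointwise. *)
Inductive tm : Type :=
  | V of nat
  | Cst of K2
  | Ap of tm & tm
  | Pr of tm & tm
  | L of tm
  | R of tm
  | Op of (nat -> nat -> nat) & tm & tm
  | Lam of tm.

Definition env : Type := seq K2.
Definition lookup (r : env) (i : nat) : K2 := nth (fun=> 0) r i.

(* [apx t r k n v]: already at stage k the n-th value of t in the environment r
   is known to be v.  Only the first k values of the entries of r are visible at
   stage k.  The body of an abstraction is run at the stage given by the length of
   the prefix s of its argument, so that it does not look beyond s and the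
   resulting code is total even when the body is not. *)
Fixpoint apx (t : tm) (r : env) (k n v : nat) : Prop :=
  match t with
  | V i => n < k /\ v = lookup r i n
  | Cst a => v = a n
  | Ap t u => exists s : seq nat,
      [/\ forall i, i < size s -> apx u r k i (nth 0 s i),
          forall j, j < size s -> apx t r k (CodeSeq.code (n :: take j s)) 0
        & apx t r k (CodeSeq.code (n :: s)) v.+1]
  | Pr t u => if odd n then apx u r k n./2 v else apx t r k n./2 v
  | L t => apx t r k n.*2 v
  | R t => apx t r k n.*2.+1 v
  | Op f t u => exists a b, [/\ apx t r k n a, apx u r k n b & v = f a b]
  | Lam t =>
      let m := head 0 (CodeSeq.decode n) in
      let s := behead (CodeSeq.decode n) in
      size s <= k /\
      ((exists2 w, apx t (nth 0 s :: r) (size s) m w & v = w.+1) \/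
       (~ (exists w, apx t (nth 0 s :: r) (size s) m w) /\ v = 0))
  end.

Definition agree (k : nat) (r r' : env) : Prop :=
  forall i n, n < k -> lookup r i n = lookup r' i n.

Lemma agree_cons k (a b : K2) r r' :
  (forall n, n < k -> a n = b n) -> agree k r r' -> agree k (a :: r) (b :: r').
Proof. by move=> ab rr' [|i] n; [exact: ab | exact: rr']. Qed.

Lemma agree_sym k r r' : agree k r r' -> agree k r' r.
Proof. by move=> rr' i n lt_n; rewrite rr'. Qed.

Lemma agree_le k k' r r' : k <= k' -> agree k' r r' -> agree k r r'.
Proof. by move=> le_k rr' i n /leq_trans/(_ le_k); apply: rr'. Qed.

Lemma apx_agree t r r' k n v : agree k r r' -> apx t r k n v -> apx t r' k n v.
Proof.
elim: t r r' k n v => [i|a|t IHt u IHu|t IHt u IHu|t IHt|t IHt|f t IHt u IHu|t IHt] //=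
    r r' k n v rr'.
- by move=> [lt_n ->]; split=> //; rewrite (rr' _ _ lt_n).
- by move=> [s [us ts tv]]; exists s; split=> [i /us|j /ts|]; eauto.
- by case: ifP => _; eauto.
- by eauto.
- by eauto.
- by move=> [a [b [ta ub ->]]]; exists a, b; split; eauto.
- set s := behead _; move=> [le_s H]; split=> //.
  have rr's : agree (size s) (nth 0 s :: r) (nth 0 s :: r').
    by apply: agree_cons => //; apply: agree_le rr'.
  case: H => [[w tw ->]|[ntw ->]]; first by left; exists w; eauto.
  (* The absence of a value has to be carried over too, which uses agreement in the reverse
     direction. *)
  by right; split=> // -[w tw]; apply: ntw; exists w; apply: IHt tw; apply: agree_sym.
Qed.

(** The stage is tested directly only as an upper bound, for variables and abstractions. The answer
    0 of an abstraction survives later stages because its body is run at stage [size s], not at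
    k. *)
Lemma apx_mono t r k k' n v : k <= k' -> apx t r k n v -> apx t r k' n v.
Proof.
move=> le_k; elim: t n v => [i|a|t IHt u IHu|t IHt u IHu|t IHt|t IHt|f t IHt u IHu|t IHt] //= n v.
- by case=> /leq_trans/(_ le_k).
- by case=> s [us ts tv]; exists s; split=> [i /us|j /ts|]; eauto.
- by case: ifP; eauto.
- by eauto.
- by eauto.
- by move=> [a [b [ta ub ->]]]; exists a, b; split; eauto.
- by case=> /leq_trans/(_ le_k).
Qed.

(** The delicate case is application: two prefixes of the argument agree as far as both reach, and
    if one were shorter, its positive final answer would contradict the 0 that the longer one
    requires there. *)
Lemma apx_inj1 t r k n v w : apx t r k n v -> apx t r k n w -> v = w.
Proof.
elim: t r k n v w => [i|a|t IHt u IHu|t IHt u IHu|t IHt|t IHt|f t IHt u IHu|t IHt] //= r k n v w.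
- by move=> [_ ->] [_ ->].
- by move=> -> ->.
- move=> [s [us ts tv]] [s' [us' ts' tw]].
  have E j : j <= size s -> j <= size s' -> take j s = take j s'.
    move=> le_s le_s'; apply: (@eq_from_nth _ 0); rewrite !size_takel // => i ij.
    rewrite !nth_take //; apply: IHu (us' _ (leq_trans ij le_s')).
    exact: us _ (leq_trans ij le_s).
  have [lt_s|lt_s|eq_s] := ltngtP (size s) (size s').
  + by have := ts' _ lt_s; rewrite -E ?take_size ?(ltnW lt_s) // => /(IHt _ _ _ _ _ tv).
  + by have := ts _ lt_s; rewrite E ?take_size ?(ltnW lt_s) // => /(IHt _ _ _ _ _ tw).
  + have ss' : s = s' by have := E _ (leqnn _); rewrite {3}eq_s !take_size; apply; rewrite eq_s.
    by rewrite ss' in tv; case: (IHt _ _ _ _ _ tv tw).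
- by case: ifP => _; [exact: IHu | exact: IHt].
- exact: IHt.
- exact: IHt.
- move=> [a [b [ta ub ->]]] [a' [b' [ta' ub' ->]]].
  by rewrite (IHt _ _ _ _ _ ta ta') (IHu _ _ _ _ _ ub ub').
- move=> [_ [[a ta ->]|[nt ->]]] [_ [[b tb ->]|[nt' ->]]] //.
  + by rewrite (IHt _ _ _ _ _ ta tb).
  + by case: nt'; exists a.
  + by case: nt; exists b.
Qed.

Lemma apx_inj t r k k' n v w : apx t r k n v -> apx t r k' n w -> v = w.
Proof.
move=> tv tw; apply: (@apx_inj1 t r (maxn k k') n).
  exact: apx_mono (leq_maxl _ _) tv.
exact: apx_mono (leq_maxr _ _) tw.
Qed.

Definition den (t : tm) (r : env) (a : K2) : Prop := forall n, exists k, apx t r k n (a n).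

Lemma den_inj t r a b : den t r a -> den t r b -> a = b.
Proof.
move=> ta tb; apply/funext => n; have [k tan] := ta n; have [k' tbn] := tb n.
exact: apx_inj tan tbn.
Qed.

Lemma den_uniform t r a N : den t r a -> exists k, forall n, n < N -> apx t r k n (a n).
Proof.
move=> ta; elim: N => [|N [k IH]]; first by exists 0.
have [k' tN] := ta N; exists (maxn k k') => n; rewrite ltnS leq_eqVlt => /orP[/eqP->|lt_n].
  exact: apx_mono (leq_maxr _ _) tN.
by apply: apx_mono (leq_maxl _ _) _; apply: IH.
Qed.

(** The first N values are all known at a single stage k, and that stage sees only the first k
    values of the environment. *)
Lemma den_continuous t r a N : den t r a ->
  exists k, forall r' b, agree k r r' -> den t r' b -> forall n, n < N -> b n = a n.
Proof.
move=> /(@den_uniform _ _ _ N)[k ta]; exists k => r' b rr' tb n lt_n.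
have [k' tbn] := tb n.
by apply: apx_inj tbn _; apply: apx_agree rr' _; apply: ta.
Qed.

Lemma den_V r i : den (V i) r (lookup r i).
Proof. by move=> n; exists n.+1. Qed.

Lemma den_Cst r a : den (Cst a) r a.
Proof. by move=> n; exists 0. Qed.

Lemma den_L t r a : den t r a -> den (L t) r (fun n => a n.*2).
Proof. by move=> ta n; apply: ta. Qed.

Lemma den_R t r a : den t r a -> den (R t) r (fun n => a n.*2.+1).
Proof. by move=> ta n; apply: ta. Qed.

Lemma den_Op f t u r a b : den t r a -> den u r b -> den (Op f t u) r (fun n => f (a n) (b n)).
Proof.
move=> ta ub n; have [k tan] := ta n; have [k' ubn] := ub n.
exists (maxn k k'), (a n), (b n); split=> //.
  exact: apx_mono (leq_maxl _ _) tan.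
exact: apx_mono (leq_maxr _ _) ubn.
Qed.

Definition pair (a b : K2) : K2 := fun n => if odd n then b n./2 else a n./2.

Lemma pairL a b : (fun n => pair a b n.*2) = a.
Proof. by apply/funext => n; rewrite /pair odd_double doubleK. Qed.

Lemma pairR a b : (fun n => pair a b n.*2.+1) = b.
Proof. by apply/funext => n; rewrite /pair /= odd_double uphalf_double. Qed.

Lemma den_Pr t u r a b : den t r a -> den u r b -> den (Pr t u) r (pair a b).
Proof.
by move=> ta ub n; rewrite /= /pair; case: ifP => _; [exact: ub | exact: ta].
Qed.

Lemma den_Ap t u r e q a : den t r e -> den u r q -> app e q a -> den (Ap t u) r a.
Proof.
move=> te uq eqa n; have [j [e0 ev]] := eqa n.
have [k1 uk] := den_uniform j uq.
(* The code is queried on the prefixes of length at most j only, so one stage covers all queries. *)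
have [k2 tk] : exists k, forall i, i <= j ->
    apx t r k (CodeSeq.code (n :: mkseq q i)) (e (CodeSeq.code (n :: mkseq q i))).
  have [k tk] := den_uniform (\max_(i < j.+1) CodeSeq.code (n :: mkseq q i)).+1 te.
  exists k => i le_i; apply: tk; rewrite ltnS.
  exact: (@leq_bigmax _ (fun i : 'I_j.+1 => CodeSeq.code (n :: mkseq q i))
    (Ordinal (le_i : i < j.+1))).
exists (maxn k1 k2), (mkseq q j); rewrite size_mkseq; split=> [i lt_i|i lt_i|].
- by rewrite nth_mkseq //; apply: apx_mono (leq_maxl _ _) _; apply: uk.
- rewrite /mkseq -map_take take_iota (minn_idPl (ltnW lt_i)).
  by apply: apx_mono (leq_maxr _ _) _; have := tk i (ltnW lt_i); rewrite e0.
- by rewrite -ev; apply: apx_mono (leq_maxr _ _) _; apply: (tk j).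
Qed.

(** Excluded middle settles each query, which makes e total. Applied to q, e waits for the first
    prefix at which the body shows a value, and by [apx_inj] this is the right one. *)
Lemma den_Lam t r : exists2 e, den (Lam t) r e &
  forall q a, den t (q :: r) a -> app e q a.
Proof.
have /choice[e te] : forall n, exists v, exists k, apx (Lam t) r k n v.
  move=> n /=; set m := head _ _; set s := behead _.
  have [[w tw]|ntw] := EM (exists w, apx t (nth 0 s :: r) (size s) m w).
    by exists w.+1, (size s); split=> //; left; exists w.
  by exists 0, (size s); split=> //; right.
exists e => // q a ta n.
have agq j : agree j (nth 0 (mkseq q j) :: r) (q :: r).
  by apply: agree_cons => // i lt_i; rewrite nth_mkseq.
have tq j : (exists2 w, apx t (q :: r) j n w & e (CodeSeq.code (n :: mkseq q j)) = w.+1) \/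
    (~ exists w, apx t (q :: r) j n w) /\ e (CodeSeq.code (n :: mkseq q j)) = 0.
  set c := CodeSeq.code _; have cK : CodeSeq.decode c = n :: mkseq q j := CodeSeq.codeK _.
  have [k /=] := te c; rewrite cK /= size_mkseq => -[_ [[w tw ew]|[ntw ew]]].
    by left; exists w => //; apply: apx_agree (agq j) tw.
  right; split=> // -[w tw]; apply: ntw; exists w.
  exact: apx_agree (agree_sym (agq j)) tw.
have exk : exists k, e (CodeSeq.code (n :: mkseq q k)) != 0.
  have [k tak] := ta n; exists k; case: (tq k) => [[w _ ->] //|[[]]].
  by exists (a n).
case: (ex_minnP exk) => k ek mink; exists k; split=> [j lt_j|].
  by apply/eqP; apply: contraTT lt_j => /mink; rewrite -leqNgt.
case: (tq k) => [[w tw ->]|[_ E]]; last by rewrite E in ek.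
by have [k' tan] := ta n; rewrite (apx_inj tw tan).
Qed.

(** * Realizability by terms *)

Definition rz (t : tm) (r : env) (p : tv) : Prop := exists2 a, den t r a & p a.

Lemma rz_V i r (p : tv) : p (lookup r i) -> rz (V i) r p.
Proof. by exists (lookup r i) => //; apply: den_V. Qed.

Lemma rz_Cst a r (p : tv) : p a -> rz (Cst a) r p.
Proof. by exists a => //; apply: den_Cst. Qed.

Lemma rz_L t r p q : rz t r (p `/\ q) -> rz (L t) r p.
Proof. by case=> a ta [pa _]; eexists; first exact: den_L ta. Qed.

Lemma rz_R t r p q : rz t r (p `/\ q) -> rz (R t) r q.
Proof. by case=> a ta [_ qa]; eexists; first exact: den_R ta. Qed.

Lemma rz_Pr t u r p q : rz t r p -> rz u r q -> rz (Pr t u) r (p `/\ q).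
Proof.
move=> [a ta pa] [b ub qb]; exists (pair a b); first exact: den_Pr.
by split; rewrite ?pairL ?pairR.
Qed.

Lemma rz_Ap t u r p q : rz t r (p `-> q) -> rz u r p -> rz (Ap t u) r q.
Proof.
move=> [e te pq] [a ua /pq[b eab qb]]; exists b => //; exact: den_Ap eab.
Qed.

Lemma rz_Lam t r (p q : tv) : (forall a, p a -> rz t (a :: r) q) -> rz (Lam t) r (p `-> q).
Proof.
move=> H; have [e te eP] := den_Lam t r; exists e => // a /H[b tb qb].
by exists b => //; apply: eP.
Qed.

(** The term does not mention x, so by [den_inj] its realizers for the various x are one and the
    same; [x0] guarantees that the term has a value. *)
Lemma rz_unif T t r (p : T -> tv) : T -> (forall x, rz t r (p x)) -> rz t r (runif p).
Proof.
move=> x0 H; have [a ta _] := H x0; exists a => // x.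
by have [b tb] := H x; rewrite (den_inj ta tb).
Qed.

Lemma rz_inst T t r (p : T -> tv) x : rz t r (runif p) -> rz t r (p x).
Proof. by case=> a ta pa; exists a. Qed.

Lemma rz_uLam T t r (p q : T -> tv) :
  (forall x a, p x a -> rz t (a :: r) (q x)) -> rz (Lam t) r (runif (fun x => p x `-> q x)).
Proof.
move=> H; have [e te eP] := den_Lam t r; exists e => // x a /H[b tb qb].
by exists b => //; apply: eP.
Qed.

Lemma rz_uuLam T U t r (p q : T -> U -> tv) :
  (forall x y a, p x y a -> rz t (a :: r) (q x y)) ->
  rz (Lam t) r (runif (fun x => runif (fun y => p x y `-> q x y))).
Proof.
move=> H; have [e te eP] := den_Lam t r; exists e => // x y a /H[b tb qb].
by exists b => //; apply: eP.
Qed.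

Lemma rz_Ap_All (X : robj) t u r (p : X -> tv) x :
  rz t r (All x of X, p x) -> rz u r (x `= x) -> rz (Ap t u) r (p x).
Proof. by move=> /(rz_inst x); apply: rz_Ap. Qed.

Lemma rz_Ex (X : robj) t r (p : X -> tv) x :
  rz t r (x `= x `/\ p x) -> rz t r (Ex x of X, p x).
Proof. by case=> a ta pa; exists a => //; exists x. Qed.

Lemma rz_Ex_inv (X : robj) t r (p : X -> tv) :
  rz t r (Ex x of X, p x) -> exists x, rz t r (x `= x `/\ p x).
Proof. by case=> a ta [x pa]; exists x, a. Qed.

(** Turns a term into an actual realizer, uniform in x. The predicate [D] carries side conditions
    without computational content, such as equality of bits in [name_eq]. *)
Lemma rz_closed T (D : T -> Prop) t (p : T -> tv) :
  (forall x, D x -> rz (Lam t) [::] (p x)) -> exists e, forall x, D x -> p x e.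
Proof.
have [e te _] := den_Lam t [::] => H; exists e => x /H[b tb].
by rewrite (den_inj te tb).
Qed.

(** Facts without computational content are derived in this classical image of the logic, which
    forgets realizers. *)
Definition inh (p : tv) : Prop := exists e, p e.

Lemma inh_rz t r p : rz t r p -> inh p.
Proof. by case=> a _; exists a. Qed.

Lemma inh_imp p q : inh (p `-> q) -> inh p -> inh q.
Proof. by move=> [e pq] [a /pq[b _]]; exists b. Qed.

Lemma inh_and p q : inh p -> inh q -> inh (p `/\ q).
Proof. by move=> [a pa] [b qb]; exists (pair a b); split; rewrite ?pairL ?pairR. Qed.

Lemma inh_All (X : robj) (p : X -> tv) x : inh (All x of X, p x) -> inh (x `= x) -> inh (p x).
Proof. by case=> e pe; apply: inh_imp; exists e; apply: pe. Qed.

Lemma inh_nat n : inh (@req natO n n).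
Proof. by exists (fun=> n). Qed.

Lemma inh_bit (b : bool) : inh (@req bitO b b).
Proof. by exists (fun=> nat_of_bool b). Qed.

(** * Points of N_oo and their names *)

Definition bitrel : Type := nat * bool -> tv.

Definition bits (x : bitrel) : nat -> bool := fun n => `[< inh (x (n, true)) >].

Definition strict (x : bitrel) : tv := runif (fun u => x u `-> @req (prodO natO bitO) u u).

Definition total (x : bitrel) : tv := All n of natO, Ex b of bitO, x (n, b).

Lemma rz_total t u r x n : rz t r (total x) -> rz u r (@req natO n n) ->
  exists b : bitO, rz (Ap t u) r (b `= b `/\ x (n, b)).
Proof.
move=> tx un; apply: rz_Ex_inv.
exact: (@rz_Ap_All natO _ _ _ (fun n => Ex b of bitO, x (n, b)) n tx un).
Qed.

Definition at_most_one (s : nat -> bool) : Prop := forall n m, s n -> s m -> n = m.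

(* [name x] is equivalent to [x `= x], but strictness and totality are the only
   parts of the latter that carry information. *)
Definition name (x : bitrel) : tv := fun e =>
  [/\ forall n b, inh (x (n, b)) -> bits x n = b, at_most_one (bits x)
    & (strict x `/\ total x) e].

Lemma rz_name t r x : (forall n b, inh (x (n, b)) -> bits x n = b) ->
  at_most_one (bits x) -> rz t r (strict x `/\ total x) -> rz t r (name x).
Proof. by move=> xb x1 [a ta xa]; exists a. Qed.

Lemma rz_name_and t r x : rz t r (name x) -> rz t r (strict x `/\ total x).
Proof. by case=> a ta [_ _ xa]; exists a. Qed.

Lemma eq_strict t r (x y : Ninf) : rz t r (x `= y) -> rz (L (L (L t))) r (strict x).
Proof. by case=> a ta [[[s _] _] _]; eexists; [exact: den_L (den_L (den_L ta)) | exact: s]. Qed.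

Lemma eq_total t r (x y : Ninf) : rz t r (x `= y) -> rz (L (R (L t))) r (total x).
Proof. by case=> a ta [[_ [s _]] _]; eexists; [exact: den_L (den_R (den_L ta)) | exact: s]. Qed.

Lemma eq_iff t r (x y : Ninf) u : rz t r (x `= y) -> rz (R (R (L (L t)))) r (x u `<-> y u).
Proof.
case=> a ta [[[_ [_ H]] _] _]; eexists; [|exact: (H u)].
exact: den_R (den_R (den_L (den_L ta))).
Qed.

(** Equality of numbers or bits is realized only if it is true. So two values at the same n, or 1s
    at two places, are excluded by single-valuedness and by the condition defining N_oo. *)
Lemma eq_bit (x y : Ninf) a : (x `= y) a ->
  (forall n b, inh (x (n, b)) -> bits x n = b) /\ at_most_one (bits x).
Proof.
case=> [[_ [_ sing]] one]; have {}sing := ex_intro _ _ sing; have {}one := ex_intro _ _ one.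
split=> [n [] xb|n m /asboolP xn /asboolP xm]; first exact/asboolP.
  apply/negP => /asboolP xt.
  have := @inh_All natO _ n sing (inh_nat n).
  move=> /(@inh_All bitO _ true)/(_ (inh_bit true)) /(@inh_All bitO _ false)/(_ (inh_bit false)).
  by move=> /inh_imp/(_ (inh_and xt xb))[? []].
have := @inh_All natO _ n one (inh_nat n).
by move=> /(@inh_All natO _ m)/(_ (inh_nat m))/inh_imp/(_ (inh_and xn xm))[? []].
Qed.

Lemma eq_bits (x y : Ninf) a : (x `= y) a -> bits x = bits y.
Proof.
case=> [[[_ [_ H]] _] _]; apply/funext => n; have [xy yx] := H (n, true).
by apply/asboolP/asboolP; [exact: (inh_imp (ex_intro _ _ xy)) | exact: (inh_imp (ex_intro _ _ yx))].
Qed.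

Lemma eq_inh (x y : Ninf) a u : (x `= y) a -> inh (x u) <-> inh (y u).
Proof.
case=> [[[_ [_ H]] _] _]; have [xy yx] := H u.
by split; [exact: (inh_imp (ex_intro _ _ xy)) | exact: (inh_imp (ex_intro _ _ yx))].
Qed.

Lemma eq_namel : exists e, forall x y : Ninf, (x `= y `-> name x) e.
Proof.
have [|e eP] := @rz_closed (Ninf * Ninf) (fun=> True)
  (Pr (L (L (L (V 0)))) (L (R (L (V 0))))) (fun p => p.1 `= p.2 `-> name p.1);
  last by exists e => x y; apply: (eP (x, y)).
move=> [x y] _; apply: rz_Lam => a xy /=; have [xb x1] := eq_bit xy; apply: rz_name => //.
by apply: rz_Pr; [apply: eq_strict | apply: eq_total]; apply: rz_V; exact: xy.
Qed.

(** Strictness of y is that of x after the implication from y to x; totality of y takes the bit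
    found for x and moves it along the implication from x to y. *)
Lemma eq_namer : exists e, forall x y : Ninf, (x `= y `-> name y) e.
Proof.
pose iff_ := R (R (L (L (V 1)))).
pose z := Ap (L (R (L (V 1)))) (V 0).
have [|e eP] := @rz_closed (Ninf * Ninf) (fun=> True)
  (Pr (Lam (Ap (L (L (L (V 1)))) (Ap (R iff_) (V 0)))) (Lam (Pr (L z) (Ap (L iff_) (R z)))))
  (fun p => p.1 `= p.2 `-> name p.2); last by exists e => x y; apply: (eP (x, y)).
move=> [x y] _; apply: rz_Lam => a xy /=; have [xb x1] := eq_bit xy.
apply: rz_name; rewrite -?(eq_bits xy) //.
  by move=> n b /(eq_inh _ xy)/xb.
have V1 q : rz (V 1) [:: q; a] (x `= y) by apply: rz_V.
apply: rz_Pr.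
  apply: rz_uLam => u q yu; apply: rz_Ap; first exact: rz_inst (eq_strict (V1 q)).
  by apply: rz_Ap; [exact: rz_R (eq_iff u (V1 q)) | apply: rz_V yu].
apply: rz_uLam => n q nn.
have [b bx] := rz_total (eq_total (V1 q)) (rz_V (i := 0) (r := [:: q; a]) nn).
apply: (@rz_Ex bitO _ _ _ b); apply: rz_Pr; first exact: rz_L bx.
by apply: rz_Ap; [exact: rz_L (eq_iff (n, b) (V1 q)) | apply: rz_R bx].
Qed.

Lemma name_eq : exists e, forall x y : Ninf, bits x = bits y ->
  (name x `/\ name y `-> x `= y) e.
Proof.
pose cp x y := Lam (R (Ap (R (y (V 1))) (L (Ap (L (x (V 1))) (V 0))))).
have [|e eP] := @rz_closed (Ninf * Ninf) (fun p => bits p.1 = bits p.2)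
  (Pr (Pr (Pr (L (L (V 0))) (Pr (Lam (L (V 0))) (Pr (cp L R) (cp R L))))
          (Pr (R (L (V 0))) (Lam (Lam (Lam (Lam (V 2)))))))
      (Lam (Lam (Lam (V 2)))))
  (fun p => name p.1 `/\ name p.2 `-> p.1 `= p.2); last by exists e => x y xy; apply: (eP (x, y)).
move=> [x y] /= xy; apply: rz_Lam => a nxy.
have [[xb x1 nx] [yb y1 ny]] := nxy.
have E q : rz (V 1) [:: q; a] (name x `/\ name y) by apply: rz_V.
have E0 : rz (V 0) [:: a] (name x `/\ name y) by apply: rz_V.
(* To pass from x' to y' at (n, b), strictness of x' yields n and totality of y' yields some bit c
   at n with a realizer; c is b because the bits agree. *)
have copy (x' y' : Ninf) lx ly :
    (forall n b, inh (x' (n, b)) -> bits x' n = b) ->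
    (forall n b, inh (y' (n, b)) -> bits y' n = b) -> bits x' = bits y' ->
    (forall q, rz lx [:: q; a] (name x')) -> (forall q, rz ly [:: q; a] (name y')) ->
    forall u, rz (Lam (R (Ap (R ly) (L (Ap (L lx) (V 0)))))) [:: a] (x' u `-> y' u).
  move=> xb' yb' xy' rx ry [n b]; apply: rz_Lam => q xq.
  have un : rz (L (Ap (L lx) (V 0))) [:: q; a] (@req natO n n).
    apply: rz_L; apply: (@rz_Ap _ _ _ (x' (n, b))); last exact: rz_V.
    exact: rz_inst (rz_L (rz_name_and (rx q))).
  have [c cy] := rz_total (rz_R (rz_name_and (ry q))) un.
  have bc : b = c.
    rewrite -(xb' n b) ?xy' ?(yb' n c) //; first by apply: inh_rz (rz_R cy).
    by exists q.
  by rewrite bc; apply: rz_R cy.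
apply: rz_Pr; first apply: rz_Pr; first apply: rz_Pr.
- exact: rz_L (rz_name_and (rz_L E0)).
- apply: rz_Pr.
    apply: rz_uuLam => -[n b] [n' b'] q H; have [_ [[/= <- _] [/= <- _]]] := H.
    by apply: rz_L; apply: rz_V H.
  apply: (rz_unif (0, true)) => u.
  apply: rz_Pr; apply: copy => // q.
  + exact: rz_L (E q).
  + exact: rz_R (E q).
  + exact: rz_R (E q).
  + exact: rz_L (E q).
- apply: rz_Pr; first exact: rz_R (rz_name_and (rz_L E0)).
  apply: (@rz_uLam natO) => n d nn; apply: (@rz_uLam bitO) => b f bb.
  apply: (@rz_uLam bitO) => b' f' bb'; apply: rz_Lam => q [xb1 xb2].
  have <- : b = b'.
    by rewrite -(xb n b) ?(xb n b') //; [exact: ex_intro xb2 | exact: ex_intro xb1].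
  exact: (rz_V (i := 2) (r := [:: q, f', f, d & _])).
- apply: (@rz_uLam natO) => n d nn; apply: (@rz_uLam natO) => m f mm.
  apply: rz_Lam => q [xn xm].
  have <- : n = m by apply: x1; apply/asboolP; [exact: ex_intro xn | exact: ex_intro xm].
  exact: (rz_V (i := 2) (r := [:: q, f, d & _])).
Qed.

(* The point of N_oo with bits s, realized by [look s], i.e. by codes of s. *)
Definition can (s : nat -> bool) : bitrel := fun u e =>
  u.2 = s u.1 /\ @req (prodO natO bitO) u u e.

Lemma inh_can s n b : inh (can s (n, b)) <-> b = s n.
Proof.
split=> [[e [] //]|/= ->].
have [e eP] := inh_and (inh_nat n) (inh_bit (s n)).
by exists e; split.
Qed.

Lemma bits_can s : bits (can s) = s.
Proof. by apply/funext => n; apply/asboolP/idP => [/inh_can <-|sn]; last exact/inh_can. Qed.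

Definition look (s : nat -> bool) : tv := All n of natO, fun e => e 0 = s n.

Lemma name_can : exists e, forall s, at_most_one s -> (look s `-> name (can s)) e.
Proof.
pose z := Ap (V 1) (V 0).
have [|e eP] := @rz_closed _ at_most_one
  (Pr (Lam (V 0)) (Lam (Pr z (Pr (V 0) z)))) (fun s => look s `-> name (can s)); last by exists e.
move=> s s1; apply: rz_Lam => a sa; apply: rz_name; rewrite ?bits_can //.
  by move=> n b /inh_can.
apply: rz_Pr; first by apply: rz_uLam => u q [_ uq]; apply: rz_V.
apply: rz_uLam => n q nn; apply: (@rz_Ex bitO _ _ _ (s n)).
have [b zb bn] : rz z [:: q; a] (fun e => e 0 = s n).
  by apply: (@rz_Ap_All natO _ _ _ (fun n e => e 0 = s n) n); exact: rz_V.
have zs : rz z [:: q; a] (@req bitO (s n) (s n)) by exists b.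
apply: rz_Pr => //.
have [c zc cP] : rz (Pr (V 0) z) [:: q; a] (@req (prodO natO bitO) (n, s n) (n, s n)).
  by apply: rz_Pr zs; apply: rz_V.
by exists c.
Qed.

Lemma look_bits : exists e, forall x, (name x `-> look (bits x)) e.
Proof.
have [|e eP] := @rz_closed bitrel (fun=> True) (Lam (L (Ap (R (V 1)) (V 0))))
  (fun x => name x `-> look (bits x)); last by exists e => x; apply: eP.
move=> x _; apply: rz_Lam => a nx; have [xb _ _] := nx.
apply: rz_uLam => n q nn.
have V1 : rz (V 1) [:: q; a] (name x) by apply: rz_V.
have [b bx] := rz_total (rz_R (rz_name_and V1)) (rz_V (i := 0) (r := [:: q; a]) nn).
have [c Lc [_ cb]] := rz_L bx.
by exists c; rewrite // (xb n b) //; apply: inh_rz (rz_R bx).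
Qed.

(** * Doubling on N_oo *)

(** On N_oo this sends n to 2n and fixes oo, the zero sequence. *)
Definition dbl (s : nat -> bool) : nat -> bool := fun n => ~~ odd n && s n./2.

Lemma dbl_double s n : dbl s n.*2 = s n.
Proof. by rewrite /dbl odd_double doubleK. Qed.

Lemma dbl_odd s n : odd n -> dbl s n = false.
Proof. by rewrite /dbl => ->. Qed.

Lemma dbl_inj : injective dbl.
Proof. by move=> s s' ss'; apply/funext => n; rewrite -dbl_double ss' dbl_double. Qed.

Lemma at_most_one_dbl s : at_most_one s -> at_most_one (dbl s).
Proof.
move=> s1 n m /andP[en sn] /andP[em sm].
by rewrite -(even_halfK en) -(even_halfK em) (s1 _ _ sn sm).
Qed.

Lemma look_dbl : exists e, forall s, (look s `-> look (dbl s)) e.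
Proof.
have [|e eP] := @rz_closed _ (fun=> True)
  (Lam (Op (fun n b => if odd n then 0 else b) (V 0) (Ap (V 1) (Op (fun n _ => n./2) (V 0) (V 0)))))
  (fun s => look s `-> look (dbl s)); last by exists e => x; apply: eP.
move=> s _; apply: rz_Lam => a sa; apply: rz_uLam => n q [_ q0].
have hq : rz (Op (fun n _ => n./2) (V 0) (V 0)) [:: q; a] (@req natO n./2 n./2).
  by eexists; [exact: den_Op (den_V _ _) (den_V _ _)|rewrite /= q0].
have [|b hb b0] := @rz_Ap_All natO (V 1) _ _ (fun n e => e 0 = s n) _ _ hq; first exact: rz_V.
eexists; first exact: den_Op (den_V _ _) hb.
by rewrite /= /lookup /= q0 b0 /dbl; case: odd.
Qed.

Lemma name_dbl : exists e, forall x, (name x `-> name (can (dbl (bits x)))) e.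
Proof.
have [e1 E1] := look_bits; have [e2 E2] := look_dbl; have [e3 E3] := name_can.
have [|e eP] := @rz_closed bitrel (fun=> True) (Ap (Cst e3) (Ap (Cst e2) (Ap (Cst e1) (V 0))))
  (fun x => name x `-> name (can (dbl (bits x)))); last by exists e => x; apply: eP.
move=> x _; apply: rz_Lam => a nx; have [_ x1 _] := nx.
apply: rz_Ap (rz_Cst _ (E3 _ (at_most_one_dbl x1))) _.
apply: rz_Ap (rz_Cst _ (E2 _)) _.
by apply: rz_Ap (rz_Cst _ (E1 _)) _; apply: rz_V.
Qed.

(** * The subsets A_g and B_g satisfy the hypotheses of the Myhill property *)

(** The exponents i and j are [e 0] and [e 1]. Here g is a bare sequence, of which the realizer
    gives no code. *)
Definition shifted (g : nat -> bool) (p : bool) (s : nat -> bool) : tv := fun e =>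
  odd (e 0 + e 1) = p /\ iter (e 1) dbl s = iter (e 0) dbl g.

(* A_g is [chain g false] and B_g is [chain g true]. *)
Definition chain (g : nat -> bool) (p : bool) (x : bitrel) : tv :=
  name x `/\ shifted g p (bits x).

(** The graph of doubling; a realizer includes names of both ends so that the relation is strict. *)
Definition double (u : bitrel * bitrel) : tv := fun e =>
  bits u.2 = dbl (bits u.1) /\ (name u.1 `/\ name u.2) e.

Lemma rz_double t r x y : bits y = dbl (bits x) ->
  rz t r (name x `/\ name y) -> rz t r (double (x, y)).
Proof. by move=> xy [a ta nn]; exists a. Qed.

Lemma rz_double_inv t r x y : rz t r (double (x, y)) ->
  bits y = dbl (bits x) /\ rz t r (name x `/\ name y).
Proof. by case=> a ta [xy nn]; split=> //; exists a. Qed.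

(** Both realizers are chosen before g and p; [den_inj] identifies the value of the term for each g
    and p with the one chosen. *)
Lemma chain_pred : exists s e, forall g p,
  runif (fun x : Ninf => chain g p x `-> x `= x) s /\
  runif (fun x : Ninf => runif (fun y : Ninf => chain g p x `/\ x `= y `-> chain g p y)) e.
Proof.
have [e2 E2] := eq_namer; have [e3 E3] := name_eq.
have [s ts _] := den_Lam (Ap (Cst e3) (Pr (L (V 0)) (L (V 0)))) [::].
have [e te _] := den_Lam (Pr (Ap (Cst e2) (R (V 0))) (R (L (V 0)))) [::].
exists s, e => g p; split.
  have [|s' /(den_inj ts) <- //] := @rz_uLam Ninf (Ap (Cst e3) (Pr (L (V 0)) (L (V 0)))) [::]
    (fun x => chain g p x) (fun x => x `= x).
  move=> x a xa; apply: rz_Ap (rz_Cst _ (E3 x x erefl)) _.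
  by apply: rz_Pr; apply: rz_L; apply: rz_V xa.
have [|e' /(den_inj te) <- //] := @rz_uuLam Ninf Ninf
  (Pr (Ap (Cst e2) (R (V 0))) (R (L (V 0)))) [::] (fun x y => chain g p x `/\ x `= y) (fun x y => chain g p y).
move=> x y a xya; have [_ xy] := xya.
apply: rz_Pr; first by apply: rz_Ap (rz_Cst _ (E2 x y)) _; apply: rz_R; apply: rz_V xya.
by rewrite -(eq_bits xy); apply: rz_R; apply: rz_L; apply: rz_V xya.
Qed.

Lemma chain_refl : exists e, forall g p, (@req (powO Ninf) (chain g p) (chain g p)) e.
Proof.
have [s [e seP]] := chain_pred.
have [|f _ fP] := @rz_unif ((nat -> bool) * bool)
  (Pr (Cst s) (Pr (Cst e) (Pr (Lam (V 0)) (Lam (V 0)))))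
  [::] (fun gp => @req (powO Ninf) (chain gp.1 gp.2) (chain gp.1 gp.2)) (xpred0, true).
  move=> [g p] /=; have [sP eP] := seP g p.
  apply: rz_Pr; first exact: rz_Cst.
  apply: rz_Pr; first exact: rz_Cst.
  apply: (rz_unif (fun _ _ => False)) => x.
  by apply: rz_Pr; apply: rz_Lam => a xa; apply: rz_V.
by exists f => g p; apply: (fP (g, p)).
Qed.

(** Going from x to 2x replaces (i, j) by (i + 1, j); coming back from 2x to x replaces (i, j) by
    (i, j + 1). Either way the parity of i + j flips. The two values of p give the two preimage
    conditions. *)
Lemma chain_preimage : exists e, forall g p,
  (@req (powO Ninf) (chain g p) (@preimage Ninf Ninf double (chain g (~~ p)))) e.
Proof.
have [s [e seP]] := chain_pred.
have [e1 E1] := name_dbl; have [e3 E3] := name_eq.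
pose N := L (V 0); pose M := Ap (Cst e1) N.
pose inc := Op (fun n _ => n.+1).
pose fwd := Pr (Ap (Cst e3) (Pr M M)) (Pr (Pr N M)
  (Pr M (Pr (inc (L (R (V 0))) (V 0)) (R (R (V 0)))))).
pose K := R (R (R (V 0))).
pose bwd := Pr (L (L (R (V 0)))) (Pr (L K) (inc (R K) (V 0))).
have [|f _ fP] := @rz_unif ((nat -> bool) * bool)
  (Pr (Cst s) (Pr (Cst e) (Pr (Lam fwd) (Lam bwd)))) [::]
  (fun gp => @req (powO Ninf) (chain gp.1 gp.2)
     (@preimage Ninf Ninf double (chain gp.1 (~~ gp.2)))) (xpred0, true); last first.
  by exists f => g p; apply: (fP (g, p)).
move=> [g p] /=; have [sP eP] := seP g p.
apply: rz_Pr; first exact: rz_Cst.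
apply: rz_Pr; first exact: rz_Cst.
apply: (rz_unif (fun _ _ => False)) => x.
apply: rz_Pr; apply: rz_Lam => a xa.
  have V0 : rz (V 0) [:: a] (chain g p x) by apply: rz_V.
  have rN : rz N [:: a] (name x) := rz_L V0.
  pose y := can (dbl (bits x)).
  have rM : rz M [:: a] (name y) := rz_Ap (rz_Cst _ (E1 x)) rN.
  apply: (@rz_Ex Ninf _ _ _ y); apply: rz_Pr.
    exact: rz_Ap (rz_Cst _ (E3 y y erefl)) (rz_Pr rM rM).
  apply: rz_Pr; first by apply: rz_double (rz_Pr rN rM); rewrite bits_can.
  apply: rz_Pr => //.
  have [b tb [b1 b2]] := rz_R V0.
  eexists; first exact: den_Pr (den_Op _ (den_L tb) (den_V _ _)) (den_R tb).
  by rewrite /shifted /pair /= bits_can -b1 -iterSr iterS b2.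
have /rz_Ex_inv[y yP] : rz (V 0) [:: a] (@preimage Ninf Ninf double (chain g (~~ p)) x).
  exact: rz_V.
have [xy nn] := rz_double_inv (rz_L (rz_R yP)).
apply: rz_Pr; first exact: rz_L nn.
have [c tc [c1 c2]] := rz_R (rz_R (rz_R yP)).
eexists; first exact: den_Pr (den_L tc) (den_Op _ (den_R tc) (den_V _ _)).
rewrite /shifted /pair /= addnS /= c1 negbK; split=> //.
by rewrite -c2 xy -iterSr iterS.
Qed.

Lemma double_exp : exists e, (@req (expO Ninf Ninf) double double) e.
Proof.
have [e1 E1] := eq_namel; have [e2 E2] := eq_namer; have [e3 E3] := name_eq.
have [e4 E4] := name_dbl.
pose dup t := Ap (Cst e3) (Pr t t).
pose N := Ap (Cst e1) (V 0); pose M := Ap (Cst e4) N.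
have [] : rz (Pr (Pr (Lam (Pr (dup (L (V 0))) (dup (R (V 0)))))
   (Pr (Lam (Pr (Ap (Cst e2) (L (R (V 0)))) (Ap (Cst e2) (R (R (V 0))))))
      (Pr (Lam (V 0)) (Lam (V 0)))))
   (Pr (Lam (Pr (dup M) (Pr N M)))
      (Lam (Lam (Lam (Lam (Ap (Cst e3) (Pr (R (L (V 0))) (R (R (V 0)))))))))))
  [::] (@req (expO Ninf Ninf) double double); last by move=> e _; exists e.
have rdup t r x : rz t r (name x) -> rz (dup t) r (@req Ninf x x).
  by move=> tx; apply: rz_Ap (rz_Cst _ (E3 x x erefl)) (rz_Pr tx tx).
apply: rz_Pr; first apply: rz_Pr.
- apply: rz_uLam => -[x y] a [_ nn].
  have E : rz (V 0) [:: a] (name x `/\ name y) by apply: rz_V.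
  by apply: rz_Pr; apply: rdup; [exact: rz_L E | exact: rz_R E].
- apply: rz_Pr.
    apply: rz_uuLam => -[x y] [x' y'] a xya; have [[/= xy _] [/= xx' yy']] := xya.
    have E : rz (R (V 0)) [:: a] (@req Ninf x x' `/\ @req Ninf y y').
      by apply: rz_R; apply: rz_V xya.
    apply: rz_double; first by rewrite -(eq_bits xx') -(eq_bits yy').
    by apply: rz_Pr; [exact: rz_Ap (rz_Cst _ (E2 x x')) (rz_L E)
                     |exact: rz_Ap (rz_Cst _ (E2 y y')) (rz_R E)].
  apply: (rz_unif (can xpred0, can xpred0)) => u.
  by apply: rz_Pr; apply: rz_Lam => a ua; apply: rz_V.
apply: rz_Pr.
  apply: (@rz_uLam Ninf) => x a xx.
  have rN : rz N [:: a] (name x) by apply: rz_Ap (rz_Cst _ (E1 x x)) _; apply: rz_V.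
  have rM := rz_Ap (rz_Cst _ (E4 x)) rN.
  apply: (@rz_Ex Ninf _ _ _ (can (dbl (bits x)))); apply: rz_Pr; first exact: rdup.
  by apply: rz_double (rz_Pr rN rM); rewrite bits_can.
apply: (@rz_uLam Ninf) => x a xx; apply: (@rz_uLam Ninf) => y b yy.
apply: (@rz_uLam Ninf) => y' c yy'; apply: rz_Lam => d yy2.
have V0 : rz (V 0) [:: d, c, b & [:: a]] (double (x, y) `/\ double (x, y')) by apply: rz_V.
have [/= xy n1] := rz_double_inv (rz_L V0).
have [/= xy' n2] := rz_double_inv (rz_R V0).
apply: rz_Ap (rz_Cst _ (E3 y y' _)) _; first by rewrite xy.
exact: rz_Pr (rz_R n1) (rz_R n2).
Qed.

Lemma double_injective : exists e, (@is_injective Ninf Ninf double) e.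
Proof.
have [e3 E3] := name_eq.
have [] : rz (Lam (Lam (Lam (Lam (Ap (Cst e3) (Pr (L (L (V 0))) (L (R (V 0)))))))))
  [::] (@is_injective Ninf Ninf double); last by move=> e _; exists e.
apply: (@rz_uLam Ninf) => x a xx; apply: (@rz_uLam Ninf) => x' b xx'.
apply: (@rz_uLam Ninf) => y c yy; apply: rz_Lam => d yy2.
have V0 : rz (V 0) [:: d, c, b & [:: a]] (double (x, y) `/\ double (x', y)) by apply: rz_V.
have [/= xy n1] := rz_double_inv (rz_L V0).
have [/= xy' n2] := rz_double_inv (rz_R V0).
apply: rz_Ap (rz_Cst _ (E3 x x' _)) _; first by apply: dbl_inj; rewrite -xy -xy'.
exact: rz_Pr (rz_L n1) (rz_L n2).
Qed.

(** * The bijections obtained from one realizer *)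

Definition matching (g : nat -> bool) (h : Ninf * Ninf -> tv) : tv :=
  @req (expO Ninf Ninf) h h `/\
  @is_bijection Ninf Ninf h `/\
  @is_bijection (subO (X := Ninf) (chain g false)) (subO (X := Ninf) (chain g true)) h.

(** Quantifiers over subsets and the realizers of the hypotheses are uniform in g, so e applied to
    them gives one r for all g. The relation h may still vary with g. *)
Lemma myhill_matching e : myhill Ninf e -> exists r, forall g, exists h, matching g h r.
Proof.
move=> eP; have [c cP] := chain_refl; have [q qP] := chain_preimage.
have [d dP] := double_exp; have [i iP] := double_injective.
pose w := Pr (Cst d) (Pr (Cst d) (Pr (Cst i) (Pr (Cst i) (Pr (Cst q) (Cst q))))).
have [|r _ rP] := @rz_unif (nat -> bool) (Ap (Ap (Ap (Cst e) (Cst c)) (Cst c)) w) [::]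
  (fun g => Ex h of expO Ninf Ninf, @is_bijection Ninf Ninf h `/\
    @is_bijection (subO (X := Ninf) (chain g false)) (subO (X := Ninf) (chain g true)) h) xpred0;
  last by exists r => g; have [h hP] := rP g; exists h.
move=> g.
have eA := rz_Ap (rz_inst (chain g false) (rz_Cst [::] eP)) (rz_Cst _ (cP g false)).
apply: rz_Ap (rz_Ap (rz_inst (chain g true) eA) (rz_Cst _ (cP g true))) _.
apply: (@rz_Ex (expO Ninf Ninf) _ _ _ double); apply: rz_Pr; first exact: rz_Cst.
apply: (@rz_Ex (expO Ninf Ninf) _ _ _ double); apply: rz_Pr; first exact: rz_Cst.
apply: rz_Pr; first exact: rz_Cst.
apply: rz_Pr; first exact: rz_Cst.
by apply: rz_Pr; apply: rz_Cst; [exact: (qP g false) | exact: (qP g true)].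
Qed.

(** A concrete code of s: for any output index it answers [s m] as soon as it has seen the first
    value m of its argument. Each query thus depends on at most one bit of s, which [hat_dirac]
    exploits. *)
Definition hat (s : nat -> bool) : K2 := fun c =>
  if behead (CodeSeq.decode c) is m :: _ then (s m).+1 else 0.

Lemma look_hat s : look s (hat s).
Proof.
move=> m q [_ qm]; exists (fun=> nat_of_bool (s m)) => // n; exists 1.
by split=> [[] // _|]; rewrite /hat CodeSeq.codeK //= qm.
Qed.

Lemma inh_name_can s : at_most_one s -> inh (name (can s)).
Proof.
have [e E] := name_can => /E s1; apply: (inh_imp (ex_intro _ _ s1)).
by exists (hat s); apply: look_hat.
Qed.

Lemma inh_name_eq (x y : Ninf) : bits x = bits y -> inh (name x) -> inh (name y) -> inh (x `= y).
Proof.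
have [e E] := name_eq => /E xy nx ny; apply: (inh_imp (ex_intro _ _ xy)); exact: inh_and.
Qed.

Lemma inh_eq_name (x y : Ninf) : inh (x `= y) -> inh (name x).
Proof. by have [e E] := eq_namel; apply: (inh_imp (ex_intro _ _ (E x y))). Qed.

Lemma inh_can_eq s : at_most_one s -> inh (@req Ninf (can s) (can s)).
Proof. by move=> /inh_name_can ns; apply: inh_name_eq. Qed.

(* A realizer of existence determines the point it realizes; this is what makes
   the bijections given by one realizer for various g coincide. *)
Lemma bits_determined t r (x y : Ninf) : rz t r (x `= x) -> rz t r (y `= y) -> bits x = bits y.
Proof.
move=> xx yy; have [e1 E1] := eq_namel; have [e2 E2] := look_bits.
apply/funext => n.
have val z : rz t r (@req Ninf z z) ->
    rz (Ap (Ap (Cst e2) (Ap (Cst e1) t)) (Cst (fun=> n))) r (fun e => e 0 = bits z n).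
  move=> zz; apply: (@rz_Ap_All natO _ _ _ (fun n e => e 0 = bits z n) n); last exact: rz_Cst.
  exact: rz_Ap (rz_Cst _ (E2 z)) (rz_Ap (rz_Cst _ (E1 z z)) zz).
have [a ta ax] := val x xx; have [b /(den_inj ta) <-] := val y yy.
by rewrite ax; case: (bits x n) (bits y n) => [] [].
Qed.

Lemma matching_ext g h r x y x' y' : matching g h r ->
  inh (h (x, y)) -> inh (@req Ninf x x') -> inh (@req Ninf y y') ->
  inh (h (x', y')).
Proof.
move=> [[[_ [ext _]] _] _] hxy xx yy; apply: (inh_imp (ex_intro _ _ (ext (x, y) (x', y')))).
by apply: inh_and => //; apply: inh_and.
Qed.

Lemma matching_single g h r x y y' : matching g h r -> inh (@req Ninf x x) -> inh (@req Ninf y y) ->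
  inh (@req Ninf y' y') -> inh (h (x, y)) -> inh (h (x, y')) -> bits y = bits y'.
Proof.
move=> [[_ [_ single]] _] xx yy yy' hxy hxy'.
have := @inh_All Ninf _ x (ex_intro _ _ single) xx.
move=> /(@inh_All Ninf _ y)/(_ yy)/(@inh_All Ninf _ y')/(_ yy').
by move=> /inh_imp/(_ (inh_and hxy hxy'))[a /eq_bits].
Qed.

Lemma matching_surjective g h r y : matching g h r -> inh (@req Ninf y y) ->
  exists2 x, inh (@req Ninf x x) & inh (h (x, y)).
Proof.
move=> [_ [[_ [_ surj]] _]] /(@inh_All Ninf _ y (ex_intro _ _ surj))[a [x [xx hxy]]].
by exists x; eexists; eauto.
Qed.

Lemma matching_total g h r x a : matching g h r -> (@req Ninf x x) a ->
  exists y, rz (Ap (L (R (L (Cst r)))) (Cst a)) [::] (@req Ninf y y `/\ h (x, y)).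
Proof.
move=> [[_ [tot _]] _] xx.
apply: (@rz_Ex_inv Ninf _ _ (fun y => h (x, y))).
apply: (@rz_Ap_All Ninf _ _ _ (fun x => Ex y of Ninf, h (x, y))); last exact: rz_Cst.
by eexists; first exact: den_L (den_R (den_L (den_Cst _ r))).
Qed.

(** The totality part of r, run on one realizer of x, has the same output for h and h'. By
    [bits_determined] that output names one point, which single-valuedness of h and of h' equates
    with y and y'. *)
Lemma matching_unique g g' h h' r x y y' : matching g h r -> matching g' h' r ->
  inh (@req Ninf x x) -> inh (@req Ninf y y) -> inh (@req Ninf y' y') ->
  inh (h (x, y)) -> inh (h' (x, y')) -> bits y = bits y'.
Proof.
move=> hr hr' xx yy yy' hxy hxy'; have [a xa] := xx.
have [z zP] := matching_total hr xa; have [z' zP'] := matching_total hr' xa.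
have zz := inh_rz (rz_L zP); have zz' := inh_rz (rz_L zP').
rewrite (matching_single hr xx yy zz hxy (inh_rz (rz_R zP))).
rewrite (matching_single hr' xx yy' zz' hxy' (inh_rz (rz_R zP'))).
exact: bits_determined (rz_L zP) (rz_L zP').
Qed.

(** * Continuity at oo *)

Definition dirac (n : nat) : nat -> bool := fun m => m == n.

Lemma at_most_one_dirac n : at_most_one (dirac n).
Proof. by move=> m m' /eqP-> /eqP->. Qed.

Lemma at_most_one_xpred0 : at_most_one xpred0.
Proof. by []. Qed.

(** The codes of n converge to the code of oo: queries below k ask for finitely many bits, and for
    large n none of them is the n-th. *)
Lemma hat_dirac k : exists N, forall n, N <= n -> agree k [:: hat xpred0] [:: hat (dirac n)].
Proof.
pose m c := head 0 (behead (CodeSeq.decode c)).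
exists (\max_(c < k) m c).+1 => n le_n [|i] c lt_c; last by rewrite /lookup /= !nth_nil.
have lt_m : m c < n := leq_ltn_trans (@leq_bigmax _ (fun c : 'I_k => m c) (Ordinal lt_c)) le_n.
move: lt_m; rewrite /lookup /= /hat /m; case: (behead _) => //= v _ lt_v.
by rewrite /dirac ltn_eqF.
Qed.

Definition near_infinity (N : nat) (s : nat -> bool) : Prop :=
  s = xpred0 \/ exists2 n, N <= n & s = dirac n.

Lemma near_infinity_one N s : near_infinity N s -> at_most_one s.
Proof. by case=> [->|[n _ ->]]; [exact: at_most_one_xpred0 | exact: at_most_one_dirac]. Qed.

Lemma matching_shift r : (forall g, exists h, matching g h r) -> exists i j N,
  odd (i + j) /\ forall g, near_infinity N g -> exists h y,
    [/\ matching g h r, inh (@req Ninf y y), inh (h (can g, y))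
      & iter j dbl (bits y) = iter i dbl g].
Proof.
move=> rP; have [e3 E3] := name_eq; have [e4 E4] := name_can.
pose N := Ap (Cst e4) (V 0).
(* The map from A_g to B_g is applied to g itself, which lies in A_g with both exponents 0. *)
pose out := Ap (L (L (R (R (Cst r))))) (Pr (Ap (Cst e3) (Pr N N)) (Pr N (Cst (fun=> 0)))).
have outP g : at_most_one g -> exists h y, [/\ matching g h r, inh (@req Ninf y y),
    inh (h (can g, y)) & rz (R (R (L out))) [:: hat g] (shifted g true (bits y))].
  move=> g1; have [h hr] := rP g; exists h.
  have rN : rz N [:: hat g] (name (can g)).
    by apply: rz_Ap (rz_Cst _ (E4 _ g1)) _; apply: rz_V; apply: look_hat.
  have [y yP] : exists y, rz out [:: hat g]
      (@req (subO (X := Ninf) (chain g true)) y y `/\ h (can g, y)).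
    apply: rz_Ex_inv; have [_ [_ [[tot _] _]]] := hr.
    apply: (@rz_Ap_All (subO (X := Ninf) (chain g false)) _ _ _
      (fun x => Ex y of subO (X := Ninf) (chain g true), h (x, y))).
      by eexists; first exact: den_L (den_L (den_R (den_R (den_Cst _ r)))).
    apply: rz_Pr; first exact: rz_Ap (rz_Cst _ (E3 _ _ erefl)) (rz_Pr rN rN).
    by apply: rz_Pr => //; apply: rz_Cst; rewrite /shifted bits_can.
  exists y; split=> //.
  - exact: inh_rz (rz_L (rz_L yP)).
  - exact: inh_rz (rz_R yP).
  - exact: rz_R (rz_R (rz_L yP)).
have [h0 [y0 [_ _ _ [a ta [odd_a _]]]]] := outP _ at_most_one_xpred0.
(* Two values suffice, since the exponents are the values at 0 and 1. *)
have [k ka] := den_continuous 2 ta; have [M MP] := hat_dirac k.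
exists (a 0), (a 1), M; split=> // g gM.
have [h [y [hr yy hy [b tb [_ bE]]]]] := outP g (near_infinity_one gM).
exists h, y; split=> //.
have ab : agree k [:: hat xpred0] [:: hat g] by case: gM => [->|[n /MP ? ->]].
by rewrite -!(ka _ _ ab tb).
Qed.

(** Each of the finitely many points n < N has one image up to bits, with at most one 1. So a finite
    point m beyond all these 1s has no preimage below N. *)
Lemma matching_bounded g h r N : matching g h r -> exists M, forall n y, n < N ->
  inh (@req Ninf y y) -> inh (h (can (dirac n), y)) -> forall m, M <= m -> bits y m = false.
Proof.
move=> hr; elim: N => [|N [M IH]]; first by exists 0.
have nn := inh_can_eq (@at_most_one_dirac N); have [a na] := nn.
have [z zP] := matching_total hr na.
have [[d zd] hz] := (inh_rz (rz_L zP), inh_rz (rz_R zP)).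
have [_ z1] := eq_bit zd.
have [M' M'P] : exists M', forall m, M' <= m -> bits z m = false.
  have [[m zm]|nz] := EM (exists m, bits z m).
    exists m.+1 => m'; apply: contraTF => /(z1 _ _ zm) <-; by rewrite ltnn.
  by exists 0 => m _; apply/negP => zm; apply: nz; exists m.
exists (maxn M M') => n y; rewrite ltnS leq_eqVlt => /orP[/eqP->|lt_n] yy hy m.
  rewrite (matching_single hr nn yy (ex_intro _ _ zd) hy hz) geq_max => /andP[_]; exact: M'P.
by rewrite geq_max => /andP[le_m _]; apply: IH hy _ le_m.
Qed.

(* No element of K2^rec realizes "N_oo has the Myhill property". *)
Theorem corollary23 : ~ valid (myhill Ninf).
Proof.
move=> [e _ /myhill_matching[r rP]].
have [i [j [N [odd_ij shift]]]] := matching_shift rP.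
have iter_inj k : injective (iter k dbl).
  by elim: k => //= k IH s s' /dbl_inj/IH.
have [ij|ji|ij] := ltngtP i j; last by rewrite ij addnn odd_double in odd_ij.
  (* Cancelling 2^i leaves 2^(j-i) y = g, impossible for an odd finite g. *)
  have [|h [y [_ _ _]]] := shift (dirac N.*2.+1).
    by right; exists N.*2.+1 => //; rewrite -addnn -addnS leq_addr.
  rewrite -(subnKC ij) addSnnS iterD => /iter_inj /(congr1 (@^~ N.*2.+1)) /=.
  by rewrite dbl_odd /= ?odd_double // /dirac eqxx.
have [h0 h0r] := rP xpred0; have [M MP] := matching_bounded N h0r.
(* This m is odd, hence not a double, and at least M, hence not the image of a point below N. *)
pose m := M.*2.+1; have odd_m : odd m by rewrite /= odd_double.
have mm := inh_can_eq (@at_most_one_dirac m).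
have [x xx hxm] := matching_surjective h0r mm.
have [x1 nx] : at_most_one (bits x) /\ inh (name x).
  by split; [case: xx => a /eq_bit[] | exact: inh_eq_name xx].
(* The facts in [shift] and [MP] concern canonical points, so x is replaced by the canonical point
   with the same bits. *)
have hsm : inh (h0 (can (bits x), can (dirac m))).
  apply: (matching_ext h0r hxm) mm; apply: inh_name_eq => //; first by rewrite bits_can.
  exact: inh_name_can.
(* With g = x, the bijection h for this g also sends x to m by [matching_unique]. Cancelling 2^j
   then exhibits m as a double. *)
have far : near_infinity N (bits x) -> False.
  move=> /shift[h [y [hr yy hy]]].
  rewrite -(subnKC ji) addSnnS iterD => /iter_inj /(congr1 (@^~ m)) /=.
  rewrite dbl_odd // -(matching_unique h0r hr (inh_can_eq x1) mm yy hsm hy).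
  by rewrite bits_can /dirac eqxx.
(* The preimage x is oo, some n >= N, or some n < N: [far] excludes the first two and [MP] the
   last. *)
have [[n xn]|x0] := EM (exists n, bits x n); last first.
  by apply: far; left; apply/funext => n; apply/negP => xn; apply: x0; exists n.
have xE : bits x = dirac n.
  by apply/funext => k; apply/idP/eqP => [/x1/(_ xn)|->].
have [le_n|lt_n] := leqP N n; first by apply: far; right; exists n.
have le_m : M <= m by rewrite /m -addnn -addnS leq_addr.
rewrite xE in hsm; have := MP n _ lt_n mm hsm m le_m.
by rewrite bits_can /dirac eqxx.
Qed.
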